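(* Let $A'$ and $A''$ be graded Artinian algebras over a field $\mathbb{K}$ of characteristic $0$, let $A=A'\otimes_{\mathbb{K}}A''$, let $L'\in A'_1$ and $L''\in A''_1$ be linear forms, and let $L=L'\otimes 1+1\otimes L''\in A_1$. Then for all $i,j\ge 0$, $$\ker(\mu_{L'})_i\otimes\ker(\mu_{L''})_j\subseteq\ker(\mu_L)_{i+j}.$$ Moreover, let $k'_i=\dim_{\mathbb{K}}\ker(\mu_{L'})_i$ and $k''_j=\dim_{\mathbb{K}}\ker(\mu_{L''})_j$. If $k'_i\cdot k''_j>0$, then $\mu_L:A_{i+j}\to A_{i+j+1}$ is neither injective nor surjective whenever at least one of the following holds: 1. $\dim_{\mathbb{K}}(A_{i+j})\le\dim_{\mathbb{K}}(A_{i+j+1})$; 2. $\dim_{\mathbb{K}}(A_{i+j})-k'_i\cdot k''_j<\dim_{\mathbb{K}}(A_{i+j+1})$.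
   Context: Graded Artinian algebras are quotients of (standard graded) polynomial rings over $\mathbb{K}$ by homogeneous ideals that are finite-dimensional over $\mathbb{K}$. The tensor product carries the total grading $A_m=\bigoplus_{a+b=m}A'_a\otimes A''_b$. For a graded algebra $B$ and a linear form $\ell\in B_1$, $\mu_\ell$ denotes multiplication by $\ell$, and $\ker(\mu_\ell)_m$ denotes the kernel of $\mu_\ell:B_m\to B_{m+1}$. *)

(* Defs.v *)
From HB Require Import structures.
From mathcomp Require Import all_boot all_order all_algebra.
From mathcomp Require Import mpoly.

Set Implicit Arguments.
Unset Strict Implicit.
Unset Printing Implicit Defensive.

Import GRing.Theory VectorInternalTheory.
Local Open Scope ring_scope.

(* MathComp's [algType] imposes 1 != 0, which would exclude the quotient of a
   polynomial ring by the unit ideal. The record below allows the zero algebra;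
   its carrier receives the library's [comPzRingType] and [vectType]
   structures. *)
Record finComAlg (K : fieldType) := FinComAlg {
  fca_vect : vectType K;
  fca_one : fca_vect;
  fca_mul : fca_vect -> fca_vect -> fca_vect;
  fca_mulA : associative fca_mul;
  fca_mulC : commutative fca_mul;
  fca_mul1 : left_id fca_one fca_mul;
  fca_mulDl : left_distributive fca_mul +%R;
  fca_scaleAl : forall (k : K) a b, k *: fca_mul a b = fca_mul (k *: a) b
}.

Definition fca_sort (K : fieldType) (B : finComAlg K) : Type := fca_vect B.
Coercion fca_sort : finComAlg >-> Sortclass.

HB.instance Definition _ (K : fieldType) (B : finComAlg K) :=
  Vector.copy (fca_sort B) (fca_vect B).
HB.instance Definition _ (K : fieldType) (B : finComAlg K) :=
  GRing.Zmodule_isComPzRing.Build (fca_sort B)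
    (@fca_mulA K B) (@fca_mulC K B) (@fca_mul1 K B) (@fca_mulDl K B).

Section FinComAlg.
Variables (K : fieldType) (B : finComAlg K).

Lemma fca_scalerAl (k : K) (a b : B) : k *: (a * b) = (k *: a) * b.
Proof. exact: fca_scaleAl. Qed.

Lemma fca_scalerAr (k : K) (a b : B) : k *: (a * b) = a * (k *: b).
Proof. by rewrite mulrC fca_scalerAl mulrC. Qed.

Definition mu (l : B) : 'End(B) := linfun (fun x : B => l * x).

Lemma muE (l x : B) : mu l x = l * x.
Proof.
have lin_l : linear (fun y : B => l * y).
  by move=> k u v; rewrite mulrDr fca_scalerAr.
pose f := HB.pack_for {linear B -> B} (fun y : B => l * y)
  (GRing.isLinear.Build K B B *:%R _ lin_l).
by rewrite /mu -[fun y => _]/(f : B -> B) lfunE.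
Qed.

(* The kernel of multiplication by l on the degree m piece, for the grading
   gr of B. *)
Definition kermu (gr : nat -> {vspace B}) (l : B) (m : nat) : {vspace B} :=
  (gr m :&: lker (mu l))%VS.

Lemma kermuP gr l m x : (x \in kermu gr l m) = (x \in gr m) && (l * x == 0).
Proof. by rewrite memv_cap memv_ker muE. Qed.

End FinComAlg.

(* A standard graded Artinian algebra: a finite-dimensional algebra presented
   as the quotient of K[x_0, ..., x_(nvars - 1)] by the ideal ker pres, which
   is homogeneous, i.e. stable under taking homogeneous components. *)
Record gradedArtinian (K : fieldType) := GradedArtinian {
  ga_alg :> finComAlg K;
  nvars : nat;
  pres : {linear {mpoly K[nvars]} -> ga_alg};
  pres_morph : monoid_morphism pres;
  pres_surj : forall a, exists p, pres p = a;
  pres_homog : forall p d, pres p = 0 -> pres (pihomog mdeg d p) = 0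
}.

Section Grading.
Variables (K : fieldType) (B : gradedArtinian K).

(* The image of the space of d-homogeneous polynomials, see [gradeP]. *)
Definition grade (d : nat) : {vspace B} :=
  (\sum_(m : 'X_{1..(nvars B) < d.+1} | mdeg m == d) <[pres B 'X_[m]]>)%VS.

Lemma gradeP d (a : B) :
  reflect (exists2 p, p \is d.-homog & pres B p = a) (a \in grade d).
Proof.
apply: (iffP memv_sumP) => [[v vP ->]|[p hp <-]].
  have {}vP m : exists c : K, mdeg (bmnm m) == d -> v m = c *: pres B 'X_[m].
    case: eqP => [/eqP/vP/vlineP[c ->]|_]; [by exists c | by exists 0].
  have [c cP] := fin_all_exists vP.
  exists (\sum_(m : 'X_{1..(nvars B) < d.+1} | mdeg m == d) c m *: 'X_[m]).
    by apply: rpred_sum => m dm; rewrite rpredZ // dhomogX.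
  by rewrite linear_sum; apply: eq_bigr => m dm; rewrite linearZ cP.
have sp : (msize p <= d.+1)%N.
  by rewrite msizeE; apply/bigmax_leqP_seq => m /(dhomog_mf hp) /= -> _.
exists (fun m : 'X_{1..(nvars B) < d.+1} => p@_m *: pres B 'X_[m]).
  by move=> m _; rewrite memvZ ?memv_line.
rewrite -[in LHS](pihomog_dE hp) (pihomogwE _ _ sp) linear_sum.
by apply: eq_bigr => m _; rewrite linearZ.
Qed.

End Grading.

(* A tensor product of algebras: a vector space with a universal bilinear map,
   multiplied factorwise. *)
Record tensorProduct (K : fieldType) (B C : finComAlg K) := TensorProduct {
  tp_alg :> finComAlg K;
  tens : {bilinear B -> C -> tp_alg};
  tens_univ : forall (E : lmodType K) (f : {bilinear B -> C -> E}),
    exists g : {linear tp_alg -> E}, forall u v, g (tens u v) = f u v;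
  tens_uniq : forall (E : lmodType K) (g h : {linear tp_alg -> E}),
    (forall u v, g (tens u v) = h (tens u v)) -> g =1 h;
  tens1 : tens 1 1 = 1;
  tensM : forall a b c d, tens a b * tens c d = tens (a * c) (b * d)
}.

Section TensorExists.
Variables (K : fieldType) (B C : finComAlg K).

Let M := 'M[K]_(dim B, dim C).
Let t (u : B) (v : C) : M := (v2r u)^T *m v2r v.
Let e (i : 'I_(dim B)) : B := r2v (delta_mx 0 i).
Let f (j : 'I_(dim C)) : C := r2v (delta_mx 0 j).
Let lift (E : lmodType K) (h : B -> C -> E) (x : M) : E :=
  \sum_i \sum_j x i j *: h (e i) (f j).

Let lift_linear (E : lmodType K) h : linear (@lift E h).
Proof.
move=> k x y; rewrite /lift scaler_sumr -big_split; apply: eq_bigr => i _ /=.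
rewrite scaler_sumr -big_split; apply: eq_bigr => j _ /=.
by rewrite !mxE scalerDl scalerA.
Qed.

Let t_bilinear : bilinear_for *:%R *:%R t.
Proof.
split=> [v|u] k x y; rewrite /t [v2r (_ + _)]linearP /=.
  by rewrite linearP /= mulmxDl -scalemxAl.
by rewrite mulmxDr -scalemxAr.
Qed.

Let te i j : t (e i) (f j) = delta_mx i j.
Proof. by rewrite /t !r2vK trmx_delta mul_delta_mx. Qed.

Let eE u : u = \sum_i v2r u 0 i *: e i.
Proof.
rewrite -[LHS]v2rK {1}(row_sum_delta (v2r u)) linear_sum.
by apply: eq_bigr => i _; rewrite linearZ.
Qed.

Let fE v : v = \sum_j v2r v 0 j *: f j.
Proof.
rewrite -[LHS]v2rK {1}(row_sum_delta (v2r v)) linear_sum.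
by apply: eq_bigr => j _; rewrite linearZ.
Qed.

Let lift_t (E : lmodType K) (h : B -> C -> E) u v :
  bilinear_for *:%R *:%R h -> lift h (t u v) = h u v.
Proof.
move=> hP; pose h' := HB.pack_for {bilinear B -> C -> E} h
  (bilinear_isBilinear.Build K B C E *:%R *:%R h hP).
rewrite -[h]/(h' : B -> C -> E) [in RHS](eE u) [in RHS](fE v) linear_sumlz.
apply: eq_bigr => i _; rewrite linear_sumr; apply: eq_bigr => j _.
by rewrite linearZl_LR linearZr_LR scalerA /t mxE big_ord1 mxE.
Qed.

Let lift_uniq (E : lmodType K) (g h : M -> E) : linear g -> linear h ->
  (forall u v, g (t u v) = h (t u v)) -> g =1 h.
Proof.
move=> gP hP gh x.
pose g' := HB.pack_for {linear M -> E} g (GRing.isLinear.Build K M E *:%R g gP).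
pose h' := HB.pack_for {linear M -> E} h (GRing.isLinear.Build K M E *:%R h hP).
rewrite -[g]/(g' : M -> E) -[h]/(h' : M -> E).
rewrite (matrix_sum_delta x) !linear_sum; apply: eq_bigr => i _.
rewrite !linear_sum; apply: eq_bigr => j _.
by rewrite !linearZ -te /= gh.
Qed.

Let tmul (x y : M) : M :=
  lift (fun a b => lift (fun c d => t (a * c) (b * d)) y) x.

Let tmul_linl y : linear (tmul^~ y).
Proof. exact: lift_linear. Qed.

Let tmul_linr x : linear (tmul x).
Proof.
have tmulE y : tmul x y = \sum_i \sum_j
    x i j *: lift (fun c d => t (e i * c) (f j * d)) y by [].
move=> k y z; rewrite !tmulE scaler_sumr -big_split.
apply: eq_bigr => i _ /=; rewrite scaler_sumr -big_split.
by apply: eq_bigr => j _ /=; rewrite lift_linear scalerDr !scalerA mulrC.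
Qed.

Let tmul_t a b c d : tmul (t a b) (t c d) = t (a * c) (b * d).
Proof.
have [tl tr] := t_bilinear.
have inner (a' : B) (b' : C) : bilinear_for *:%R *:%R (fun c d => t (a' * c) (b' * d)).
  split=> [v|u] k x y.
    by rewrite mulrDr -fca_scalerAr; apply: tl.
  by rewrite mulrDr -fca_scalerAr; apply: tr.
rewrite /tmul lift_t ?lift_t //; split=> [v|u] k x y; rewrite !lift_t //.
  by rewrite mulrDl -fca_scalerAl; apply: tl.
by rewrite mulrDl -fca_scalerAl; apply: tr.
Qed.

Let lin_comp (g h : M -> M) : linear g -> linear h -> linear (fun x => g (h x)).
Proof. by move=> gP hP k x y; rewrite hP gP. Qed.

Let tmulC : commutative tmul.
Proof.
move=> x y; move: x; apply: lift_uniq => // a b; move: y.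
by apply: lift_uniq => // c d; rewrite !tmul_t mulrC [b * d]mulrC.
Qed.

Let tmulA : associative tmul.
Proof.
move=> x y z; move: x.
apply: lift_uniq => [||a b]; [exact: tmul_linl | | move: y];
  first exact: lin_comp (tmul_linl z) (tmul_linl y).
apply: lift_uniq => [||c d]; [| | move: z];
  [ exact: lin_comp (tmul_linr _) (tmul_linl z)
  | exact: lin_comp (tmul_linl z) (tmul_linr _) |].
apply: lift_uniq => [||u v]; [| exact: tmul_linr |];
  first exact: lin_comp (tmul_linr _) (tmul_linr _).
by rewrite !tmul_t !mulrA.
Qed.

Let tmul1 : left_id (t 1 1) tmul.
Proof. by apply: lift_uniq => // a b; rewrite tmul_t !mul1r. Qed.

Let tmulDl : left_distributive tmul +%R.
Proof. by move=> x y z; rewrite -[x]scale1r tmul_linl !scale1r. Qed.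

Let tscaleAl (k : K) x y : k *: tmul x y = tmul (k *: x) y.
Proof.
have t0 : tmul 0 y = 0 by have := tmulDl 0 0 y; rewrite addr0 => /esym/eqP;
  rewrite -subr_eq0 addrK => /eqP.
by rewrite -[k *: x]addr0 tmul_linl t0 addr0.
Qed.

Let tAlg := FinComAlg tmulA tmulC tmul1 tmulDl tscaleAl.

Lemma tensorProduct_exists : inhabited (tensorProduct B C).
Proof.
pose T := HB.pack_for {bilinear B -> C -> tAlg} (t : B -> C -> tAlg)
  (bilinear_isBilinear.Build K B C tAlg *:%R *:%R t t_bilinear).
constructor; apply: (@TensorProduct K B C tAlg T) => [E h|E g h gh|//|].
- exists (HB.pack_for {linear tAlg -> E} (lift h : tAlg -> E)
    (GRing.isLinear.Build K tAlg E *:%R (lift h) (@lift_linear E h))).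
  by move=> u v; apply: lift_t; split=> [w|w] k x y; [exact: linearPl | exact: linearPr].
- by apply: lift_uniq => // k x y; rewrite linearP.
- exact: tmul_t.
Qed.

End TensorExists.

Section Tensor.
Variables (K : fieldType) (B C : finComAlg K) (A : tensorProduct B C).

(* U (x) V, identified with its image in B (x) C. *)
Definition tensv (U : {vspace B}) (V : {vspace C}) : {vspace A} :=
  <<[seq tens A u v | u <- vbasis U, v <- vbasis V]>>%VS.

Lemma memv_tens (U : {vspace B}) (V : {vspace C}) u v : u \in U -> v \in V -> tens A u v \in tensv U V.
Proof.
move=> uU vV; rewrite (coord_vbasis uU) (coord_vbasis vV).
rewrite linear_sumlz /=; apply: rpred_sum => i _.
rewrite linearZl_LR; apply: rpredZ.
rewrite linear_sumr /=; apply: rpred_sum => j _.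
rewrite linearZr_LR; apply/rpredZ/memv_span/allpairs_f;
  by rewrite mem_nth // size_tuple.
Qed.

Lemma tensv_subP (U : {vspace B}) (V : {vspace C}) (W : {vspace A}) :
  reflect (forall u v, u \in U -> v \in V -> tens A u v \in W)
          (tensv U V <= W)%VS.
Proof.
apply: (iffP idP) => [sW u v uU vV|sW].
  by apply: (subvP sW); apply: memv_tens.
apply/span_subvP => _ /allpairsP[[u v] /= [uU vV ->]].
by apply: sW; apply: vbasis_mem.
Qed.

End Tensor.

Definition tgrade (K : fieldType) (B C : gradedArtinian K)
    (A : tensorProduct B C) (m : nat) : {vspace A} :=
  (\sum_(a < m.+1) tensv A (grade B a) (grade C (m - a)))%VS.

Lemma tens_linear_form (K : fieldType) (B C : gradedArtinian K)
    (A : tensorProduct B C) (u : B) (v : C) :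
  u \in grade B 1 -> v \in grade C 1 ->
  tens A u 1 + tens A 1 v \in tgrade A 1.
Proof.
have one0 (D : gradedArtinian K) : 1 \in grade D 0.
  by apply/gradeP; exists 1; rewrite ?dhomog1 ?(pres_morph D).1.
move=> u1 v1; rewrite /tgrade !big_ord_recr big_ord0 /= add0v addrC.
by apply: memv_add; apply: memv_tens; rewrite ?subnn ?subn0 ?one0.
Qed.

(* Main.v *)
(* The tensor product of the two kernels has dimension >= k'k'': coordinates along
   bases of the factors give a bilinear map to k' x k'' matrices, and the induced
   linear map is onto. Hence mu_L kills a subspace of dimension at least k'k'' > 0
   of A_(i+j), so it is not injective there; each of the two numerical hypotheses
   makes its image of dimension smaller than that of A_(i+j+1). *)
From HB Require Import structures.
Require Import Defs.
From mathcomp Require Import all_boot all_order all_algebra.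
From mathcomp Require Import mpoly.
From mathcomp Require Import zify.

Set Implicit Arguments.
Unset Strict Implicit.
Unset Printing Implicit Defensive.

Import GRing.Theory.
Local Open Scope ring_scope.

Lemma dim_tensv_ge (K : fieldType) (B C : finComAlg K) (A : tensorProduct B C)
    (U : {vspace B}) (V : {vspace C}) :
  (\dim U * \dim V <= \dim (tensv A U V))%N.
Proof.
pose h (u : B) (v : C) : 'M[K]_(\dim U, \dim V) :=
  \matrix_(i, j) (coord (vbasis U) i u * coord (vbasis V) j v).
have hP : bilinear_for *:%R *:%R h.
  split=> [v|u] k x y; apply/matrixP=> i j; rewrite !mxE linearP /=.
    by rewrite mulrDl mulrA.
  by rewrite mulrDr mulrCA.
pose hB := HB.pack_for {bilinear B -> C -> 'M[K]_(\dim U, \dim V)} h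
  (bilinear_isBilinear.Build K B C _ *:%R *:%R h hP).
have [g gE] := tens_univ A hB.
have g_onto : (fullv <= linfun g @: tensv A U V)%VS.
  apply/subvP=> M _; rewrite (matrix_sum_delta M).
  apply: rpred_sum => i _; apply: rpred_sum => j _; apply: rpredZ.
  (* Matrix units span the target. The one at [(i, j)] comes from the tensor of the [i]-th and
     [j]-th basis vectors, since [coord] is dual to a free family. *)
  have -> : delta_mx i j = linfun g (tens A (vbasis U)`_i (vbasis V)`_j).
    rewrite lfunE /= gE; apply/matrixP=> r s.
    rewrite !mxE !coord_free ?(basis_free (vbasisP _)) //.
    by rewrite -natrM mulnb [i == r]eq_sym [j == s]eq_sym.
  by apply: memv_img; apply: memv_tens; apply/vbasis_mem/mem_nth;
    rewrite size_tuple.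
(* Rank-nullity for [g] restricted to [tensv A U V]: its image already fills a space of dimension
   [\dim U * \dim V]. *)
rewrite -(limg_ker_dim (linfun g)) -[leqLHS](dim_matrix K) -dimvf.
exact: leq_trans (dimvS g_onto) (leq_addl _ _).
Qed.

(** Pure tensors suffice: multiplying [x] (x) [y] by the form gives [ux] (x) [y] + [x] (x) [vy], and
    both terms vanish. *)
Lemma tensv_kermu_sub (K : fieldType) (B C : gradedArtinian K)
    (A : tensorProduct B C) (u : B) (v : C) (i j : nat) :
  (tensv A (kermu (grade B) u i) (kermu (grade C) v j)
     <= kermu (tgrade A) (tens A u 1 + tens A 1 v)%R (i + j))%VS.
Proof.
apply/tensv_subP=> x y; rewrite !kermuP => /andP[xi /eqP ux] /andP[yj /eqP vy].
apply/andP; split; last first.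
  rewrite mulrDl; have -> := tensM A u 1 x y; have -> := tensM A 1 v x y.
  by rewrite ux vy linear0l linear0r addr0.
(* Membership in degree [i + j] is witnessed by the summand of index [a = i], whose second factor
   has degree [i + j - i = j]. *)
have i_lt : (i < (i + j).+1)%N by rewrite ltnS leq_addr.
apply: (subvP (sumv_sup (Ordinal i_lt) _ (subvv _))) => //=.
by rewrite addKn memv_tens.
Qed.

Theorem lemma4p1 (K : fieldType) (char0 : [pchar K] =i pred0)
    (A' A'' : gradedArtinian K) (A : tensorProduct A' A'')
    (L' : A') (L'' : A'')
    (hL' : L' \in grade A' 1) (hL'' : L'' \in grade A'' 1) :
  let L : A := tens A L' 1 + tens A 1 L'' in
  (forall i j : nat,
     (tensv A (kermu (grade A') L' i) (kermu (grade A'') L'' j)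
        <= kermu (tgrade A) L (i + j))%VS) /\
  (forall i j : nat,
     let k' := \dim (kermu (grade A') L' i) in
     let k'' := \dim (kermu (grade A'') L'' j) in
     (0 < k' * k'')%N ->
     (\dim (tgrade A (i + j)) <= \dim (tgrade A (i + j).+1))%N \/
     ((\dim (tgrade A (i + j)))%:Z - (k' * k'')%N%:Z
        < (\dim (tgrade A (i + j).+1))%:Z) ->
     ~ {in tgrade A (i + j) &, injective (mu L)} /\
     ~ (forall y : A, y \in tgrade A (i + j).+1 ->
          exists2 x : A, x \in tgrade A (i + j) & mu L x = y)).
Proof.
move=> L; have ker_sub := tensv_kermu_sub A L' L''.
split=> [i j|i j k' k'' k_gt0 dim_le]; first exact: ker_sub.
have ker_ge : (k' * k'' <= \dim (kermu (tgrade A) L (i + j)))%N.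
  exact: leq_trans (dim_tensv_ge A _ _) (dimvS (ker_sub i j)).
split=> [mu_inj|mu_onto].
  suff /eqP ker0 : kermu (tgrade A) L (i + j) == 0%VS.
    by move: ker_ge; rewrite ker0 dimv0 leqNgt k_gt0.
  rewrite -subv0; apply/subvP=> x; rewrite memv_cap memv_ker => /andP[xA /eqP Lx].
  by rewrite memv0; apply/eqP/mu_inj; rewrite ?mem0v // Lx linear0.
have img_ge : (\dim (tgrade A (i + j).+1) <= \dim (mu L @: tgrade A (i + j)))%N.
  by apply/dimvS/subvP=> y /mu_onto[x xA <-]; apply: memv_img.
have rank_nullity : (\dim (kermu (tgrade A) L (i + j)) +
    \dim (mu L @: tgrade A (i + j)) = \dim (tgrade A (i + j)))%N.
  exact: limg_ker_dim.
(* Surjectivity would force [\dim (tgrade A (i + j).+1)] to be at most [\dim (tgrade A (i + j))]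
   minus [k' * k'']. This denies the second alternative outright, and the first because [k' * k'']
   is positive. *)
lia.
Qed.
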